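(* Let $(P,\{\cdot,\cdot\})$ be a Poisson manifold endowed with a Riemannian metric $g$, and let $K\in C_b^3(P\times P)$ be a Mercer kernel with RKHS $\mathcal{H}_K$. Suppose the compatible structure $J$ satisfies $g(z)(J(z)v,J(z)v)\le\gamma(z)\,g(z)(v,v)$ for all $z\in P$, $v\in T_zP$, where $\gamma$ is a positive function on $P$ bounded above by a constant $C^2$ ($C>0$). Then for every $\lambda>0$ the estimator $$\widehat h_{\lambda,N}:=\mathop{\arg\min}_{h\in\mathcal{H}_K}\ \frac1N\sum_{n=1}^N\big\|X_h(\mathbf{Z}^{(n)})-\mathbf{X}^{(n)}_{\sigma^2}\big\|_g^2+\lambda\|h\|_{\mathcal{H}_K}^2$$ can be written as $$\widehat h_{\lambda,N}=g_N\big(\widehat{\mathbf c},X_{K_\cdot}(\mathbf{Z}_N)\big),$$ where $\widehat{\mathbf c}\in T_{\mathbf{Z}_N}P$ is given by $$\widehat{\mathbf c}=(G_N+\lambda N I)^{-1}\mathbf{X}_{\sigma^2,N}.$$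
   Context: Mercer kernel: symmetric positive semidefinite function $K:P\times P\to\mathbb{R}$; $\mathcal{H}_K$ is its reproducing kernel Hilbert space; $K_x:=K(x,\cdot)$. Poisson tensor $B$: $B(z)(\mathbf{d}F(z),\mathbf{d}G(z))=\{F,G\}(z)$; $B^\sharp:T^*P\to TP$ is given by $B(z)(\alpha,\beta)=\alpha\cdot B^\sharp(z)(\beta)$. The Hamiltonian vector field of $h$ is $X_h=B^\sharp(\mathbf{d}h)$. The compatible structure is $J:TP\to TP$, $J(z)v=B^\sharp(z)(g^\flat(z)(v))$, so $X_h=J\nabla h$. $C_b^s$ spaces: for a second-countable manifold $M$ with complete Riemannian metric $g=g_0$ and fixed complete Riemannian metrics $g_k$ (norm $\|\cdot\|_k$) on the iterated tangent bundles $T^kM=T(T^{k-1}M)$, and with $D^kf:T^kM\to\mathbb{R}$ the differential of $D^{k-1}f:T^{k-1}M\to\mathbb{R}$, $C_b^s(M)$ is the set of $f\in C^s(M)$ with $\|f\|_{C_b^s}:=\|f\|_\infty+\sum_{k=1}^s\|D^kf\|_\infty<\infty$, where $\|D^kf\|_\infty=\sup_{y\in T^{k-1}M}\sup_{0\ne v\in T_y(T^{k-1}M)}|D^kf(y)\cdot v|/\|v\|_{k-1}$; $C_b^s(P\times P)$ is this space for the product manifold. Data: $\mathbf{X}^{(n)}_{\sigma^2}=X_H(\mathbf{Z}^{(n)})+\boldsymbol\varepsilon^{(n)}\in T_{\mathbf{Z}^{(n)}}P$, $n=1,\dots,N$, where $H\in C^\infty(P)$, $\mathbf{Z}^{(n)}$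 are IID $P$-valued random variables, and $\boldsymbol\varepsilon^{(n)}$ are independent tangent-space-valued random variables with mean zero and variance $\sigma^2I_d$, $d=\dim P$. Write $\mathbf{Z}_N=(\mathbf{Z}^{(1)},\dots,\mathbf{Z}^{(N)})$, $\mathbf{X}_{\sigma^2,N}=(\mathbf{X}^{(1)}_{\sigma^2},\dots,\mathbf{X}^{(N)}_{\sigma^2})$, $T_{\mathbf{Z}_N}P=\prod_{i=1}^NT_{\mathbf{Z}^{(i)}}P$, $g_N(u,v)=\sum_{i=1}^Ng(\mathbf{Z}^{(i)})(u_i,v_i)$ for $u,v\in T_{\mathbf{Z}_N}P$. For a function $h$, $X_h(\mathbf{Z}_N)=(X_h(\mathbf{Z}^{(1)}),\dots,X_h(\mathbf{Z}^{(N)}))$. For $\mathbf{c}\in T_{\mathbf{Z}_N}P$, $g_N(\mathbf c,X_{K_\cdot}(\mathbf{Z}_N))$ denotes the function $y\mapsto g_N(\mathbf c,X_{K_y}(\mathbf{Z}_N))$ on $P$. The generalized differential Gram matrix is the linear map $G_N:T_{\mathbf{Z}_N}P\to T_{\mathbf{Z}_N}P$, $G_N\mathbf c:=X_{g_N(\mathbf c,X_{K_\cdot}(\mathbf{Z}_N))}(\mathbf{Z}_N)$. *)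

(* Defs.v *)
From HB Require Import structures.
From mathcomp Require Import all_boot all_order all_algebra.
From mathcomp Require Import all_classical all_reals all_analysis.
Set Implicit Arguments.
Unset Strict Implicit.
Unset Printing Implicit Defensive.
Import Order.TTheory GRing.Theory Num.Theory.
Import numFieldNormedType.Exports.
Local Open Scope classical_set_scope.
Local Open Scope ring_scope.

(* f is of class C^k on U; only used for U open. *)
Fixpoint Ck (R : realType) (V W : normedModType R) (k : nat) (U : set V)
    (f : V -> W) : Prop :=
  if k is k'.+1 then
    (forall x, U x -> differentiable f x) /\
    (forall v, Ck k' U (fun x => 'd f x v))
  else forall x, U x -> {for x, continuous f}.

Definition Coo (R : realType) (V W : normedModType R) (U : set V)
  (f : V -> W) : Prop := forall k, Ck k U f.

(* A chart is a partial bijection: cmap matters only on cdom, and cinv only on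
   cmap @` cdom. *)
Record chart (M V : Type) := Chart {
  cdom : set M;
  cmap : M -> V;
  cinv : V -> M }.

(* A set with an atlas; the axioms are in [manifold] below. The distinguished
   chart at each point carries no extra geometric information: it is only used
   to represent tangent vectors by coordinates. *)
Record atlas (R : realType) := Atlas {
  carrier :> Type;
  mdim : nat;
  charts : set (chart carrier 'rV[R]_mdim);
  chart_at : carrier -> chart carrier 'rV[R]_mdim }.

(* The manifold topology: the one generated by the sets cdom c `&` cmap c @^-1` U
   with c a chart and U open. *)
HB.instance Definition _ (R : realType) (M : atlas R) :=
  gen_eqMixin (carrier M).
HB.instance Definition _ (R : realType) (M : atlas R) :=
  gen_choiceMixin (carrier M).
HB.instance Definition _ (R : realType) (M : atlas R) :=
  isSubBaseTopological.Build (carrier M)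
    [set A : set M | exists c (U : set 'rV[R]_(mdim M)),
       [/\ charts c, open U & A = cdom c `&` cmap c @^-1` U]]
    id.

Record manifold (R : realType) (M : atlas R) : Prop := Manifold {
  chart_cancel : forall c : chart M _, charts c ->
    forall x, cdom c x -> cinv c (cmap c x) = x;
  chart_open : forall c c' : chart M _, charts c -> charts c' ->
    open (cmap c @` (cdom c `&` cdom c'));
  chart_smooth : forall c c' : chart M _, charts c -> charts c' ->
    Coo (cmap c @` (cdom c `&` cdom c')) (cmap c' \o cinv c);
  chart_at_charts : forall x : M, charts (chart_at x);
  chart_at_dom : forall x : M, cdom (chart_at x) x;
  manifold_hausdorff : hausdorff_space M;
  manifold_second_countable : @second_countable M }.

(* T_x M, a tangent vector being represented by its coordinates in the chart
   [chart_at x]. *)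
Definition tspace (R : realType) (M : atlas R) (x : M) : normedModType R :=
  'rV[R]_(mdim M).

(* Coordinates in the chart c of a tangent vector at x, and conversely. *)
Definition to_chart (R : realType) (M : atlas R) (c : chart M 'rV[R]_(mdim M))
    (x : M) (v : tspace x) : 'rV[R]_(mdim M) :=
  'd (cmap c \o cinv (chart_at x)) (cmap (chart_at x) x) v.

Definition of_chart (R : realType) (M : atlas R) (c : chart M 'rV[R]_(mdim M))
    (x : M) (a : 'rV[R]_(mdim M)) : tspace x :=
  'd (cmap (chart_at x) \o cinv c) (cmap c x) a.

Definition tangent_chart (R : realType) (M : atlas R)
    (c : chart M 'rV[R]_(mdim M)) :
    chart (M * 'rV[R]_(mdim M)) 'rV[R]_(mdim M + mdim M) :=
  Chart (fun w => cdom c w.1)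
    (fun w => row_mx (cmap c w.1) (to_chart c (w.2 : tspace w.1)))
    (fun y => (cinv c (lsubmx y), of_chart c (cinv c (lsubmx y)) (rsubmx y))).

Definition tangent (R : realType) (M : atlas R) : atlas R :=
  Atlas (@tangent_chart R M @` @charts R M)
    (fun w => tangent_chart (chart_at w.1)).

Definition tpoint (R : realType) (M : atlas R) (x : M) (v : tspace x) :
  tangent M := (x, v).

Fixpoint itangent (R : realType) (k : nat) (M : atlas R) : atlas R :=
  if k is k'.+1 then tangent (itangent k' M) else M.

Definition prod_chart (R : realType) (M N : atlas R)
    (c : chart M 'rV[R]_(mdim M)) (c' : chart N 'rV[R]_(mdim N)) :
    chart (M * N) 'rV[R]_(mdim M + mdim N) :=
  Chart (fun p => cdom c p.1 /\ cdom c' p.2)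
    (fun p => row_mx (cmap c p.1) (cmap c' p.2))
    (fun y => (cinv c (lsubmx y), cinv c' (rsubmx y))).

Definition mprod (R : realType) (M N : atlas R) : atlas R :=
  Atlas [set cc | exists c c',
           [/\ @charts R M c, @charts R N c' & cc = prod_chart c c']]
    (fun p => prod_chart (chart_at p.1) (chart_at p.2)).

Definition Ck_fun (R : realType) (M : atlas R) (k : nat) (f : M -> R) : Prop :=
  forall c : chart M _, charts c ->
    @Ck R _ R k (cmap c @` cdom c) (f \o cinv c).

Definition Coo_fun (R : realType) (M : atlas R) (f : M -> R) : Prop :=
  forall k, Ck_fun k f.

Definition cotspace (R : realType) (M : atlas R) (x : M) : vectType R :=
  'Hom('rV[R]_(mdim M), R^o).

Definition pairing (R : realType) (M : atlas R) (x : M) (alpha : cotspace x)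
  (v : tspace x) : R := (alpha : 'Hom('rV[R]_(mdim M), R^o)) v.

Definition dfun (R : realType) (M : atlas R) (f : M -> R) (x : M) :
    cotspace x :=
  linfun ('d (f \o cinv (chart_at x) : _ -> R^o) (cmap (chart_at x) x)).

Section Riemannian.
Variables (R : realType) (M : atlas R).

Definition metric := forall x : M, tspace x -> tspace x -> R.

Record riemannian (g : metric) : Prop := Riemannian {
  metric_linear : forall x (v : tspace x), scalar (g x v);
  metric_sym : forall x (v w : tspace x), g x v w = g x w v;
  metric_pos : forall x (v : tspace x), v != 0 -> 0 < g x v v;
  metric_smooth : forall c : chart M _, charts c ->
    forall a b : 'rV[R]_(mdim M),
    @Coo R _ R (cmap c @` cdom c) (fun p =>
      g (cinv c p) (of_chart c (cinv c p) a) (of_chart c (cinv c p) b)) }.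

Definition gnorm (g : metric) (x : M) (v : tspace x) : R :=
  Num.sqrt (g x v v).

Definition C1_curve (gam : R -> M) : Prop :=
  forall c : chart M _, charts c ->
    open (gam @^-1` cdom c) /\
    @Ck R R^o _ 1 (gam @^-1` cdom c) (cmap c \o gam).

Definition velocity (gam : R -> M) (t : R) : tspace (gam t) :=
  derive1 (cmap (chart_at (gam t)) \o gam) t.

Definition curve_length (g : metric) (gam : R -> M) : \bar R :=
  (\int[lebesgue_measure]_(t in `[0%R, 1%R]) (gnorm g (velocity gam t))%:E)%E.

(* Reparametrizing a piecewise C^1 path so that it stops at its corners and at
   its ends makes it C^1 on the whole line, without changing its length; so
   this is the usual Riemannian distance (+oo between distinct components). *)
Definition riem_dist (g : metric) (x y : M) : \bar R :=
  ereal_inf [set curve_length g gam | gam in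
    [set gam | [/\ C1_curve gam, gam 0 = x & gam 1 = y]]].

Definition complete_metric (g : metric) : Prop :=
  forall u : nat -> M,
    (forall e : R, 0 < e -> exists n0, forall m n, (n0 <= m)%N -> (n0 <= n)%N ->
      (riem_dist g (u m) (u n) < e%:E)%E) ->
    exists x, (fun n => riem_dist g (u n) x) @ \oo --> 0%E.

(* The maximum with 0 only matters when M is empty or 0-dimensional. *)
Definition sup_norm (f : M -> R) : \bar R :=
  maxe 0%E (ereal_sup [set `|f x|%:E | x in [set: M]]).

Definition dsup_norm (g : metric) (f : M -> R) : \bar R :=
  maxe 0%E (ereal_sup [set r | exists x, exists2 v : tspace x, v != 0 &
    r = (`|pairing (dfun f x) v| / gnorm g v)%:E]).

End Riemannian.

Fixpoint Dk (R : realType) (M : atlas R) (f : M -> R) (k : nat) :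
    itangent k M -> R :=
  match k return itangent k M -> R with
  | 0%N => f
  | k'.+1 => fun w => @pairing R (itangent k' M) w.1 (dfun (Dk f (k := k')) w.1) w.2
  end.
Arguments Dk {R M} f k.

(* The k-th summand (k counted from 0) is the sup-norm of D^(k+1) f, i.e. of the differential of
   D^k f, measured with the metric of the k-th iterated tangent bundle. *)
Definition Cb_norm (R : realType) (M : atlas R)
    (gk : forall k, metric (itangent k M)) (s : nat) (f : M -> R) : \bar R :=
  (sup_norm f + \sum_(0 <= k < s) dsup_norm (gk k) (Dk f k))%E.

Definition Cb (R : realType) (M : atlas R)
    (gk : forall k, metric (itangent k M)) (s : nat) (f : M -> R) : Prop :=
  Ck_fun s f /\ (Cb_norm gk s f < +oo)%E.

Section Poisson.
Variables (R : realType) (P : atlas R).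

Record poisson_bracket (br : (P -> R) -> (P -> R) -> P -> R) : Prop :=
    PoissonBracket {
  bracket_smooth : forall F G, Coo_fun F -> Coo_fun G -> Coo_fun (br F G);
  bracket_linear : forall a F G H, Coo_fun F -> Coo_fun G -> Coo_fun H ->
    br ((a \*: F) \+ G) H = (a \*: br F H) \+ br G H;
  bracket_skew : forall F G z, Coo_fun F -> Coo_fun G ->
    br F G z = - br G F z;
  bracket_jacobi : forall F G H z, Coo_fun F -> Coo_fun G -> Coo_fun H ->
    br F (br G H) z + br G (br H F) z + br H (br F G) z = 0;
  bracket_leibniz : forall F G H z, Coo_fun F -> Coo_fun G -> Coo_fun H ->
    br (F \* G) H z = F z * br G H z + br F H z * G z }.

Definition bivector := forall z : P, cotspace z -> cotspace z -> R.

Record poisson_tensor (br : (P -> R) -> (P -> R) -> P -> R) (B : bivector) :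
    Prop := PoissonTensor {
  tensor_linear_l : forall z (beta : cotspace z), scalar (B z ^~ beta);
  tensor_linear_r : forall z (alpha : cotspace z), scalar (B z alpha);
  tensor_bracket : forall F G z, Coo_fun F -> Coo_fun G ->
    B z (dfun F z) (dfun G z) = br F G z }.

Definition bundle_map := forall z : P, cotspace z -> tspace z.

Definition is_sharp (B : bivector) (Bsharp : bundle_map) : Prop :=
  forall z (alpha beta : cotspace z), B z alpha beta = pairing alpha (Bsharp z beta).

(* Meaningful when h is differentiable at z, as are all elements of the RKHS of
   a C^3 kernel. *)
Definition hamiltonian (Bsharp : bundle_map) (h : P -> R) (z : P) : tspace z :=
  Bsharp z (dfun h z).

Definition flat (g : metric P) (z : P) (v : tspace z) : cotspace z :=
  linfun (g z v : 'rV[R]_(mdim P) -> R^o).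

Definition compatible_structure (g : metric P) (Bsharp : bundle_map) (z : P)
    (v : tspace z) : tspace z :=
  Bsharp z (flat g v).

End Poisson.

Section RKHS.
Variables (R : realType) (T : Type).

Definition mercer (K : T -> T -> R) : Prop :=
  (forall x y, K x y = K y x) /\
  (forall n (x : 'I_n -> T) (a : 'I_n -> R),
     0 <= \sum_(i < n) \sum_(j < n) a i * a j * K (x i) (x j)).

(* The reproducing kernel Hilbert space of K, which is unique: HK is its set of
   elements and ip its inner product. *)
Record rkhs (K : T -> T -> R) (HK : set (T -> R))
    (ip : (T -> R) -> (T -> R) -> R) : Prop := Rkhs {
  rkhs_kernel : forall x, HK (K x);
  rkhs_linear : forall a f h, HK f -> HK h -> HK ((a \*: f) \+ h);
  rkhs_ip_linear : forall a f f' h, HK f -> HK f' -> HK h ->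
    ip ((a \*: f) \+ f') h = a * ip f h + ip f' h;
  rkhs_ip_sym : forall f h, HK f -> HK h -> ip f h = ip h f;
  rkhs_ip_ge0 : forall f, HK f -> 0 <= ip f f;
  rkhs_ip_eq0 : forall f, HK f -> ip f f = 0 -> forall x, f x = 0;
  rkhs_complete : forall u : nat -> T -> R, (forall n, HK (u n)) ->
    (forall e : R, 0 < e -> exists n0, forall m n, (n0 <= m)%N -> (n0 <= n)%N ->
       Num.sqrt (ip (u m \- u n) (u m \- u n)) < e) ->
    exists2 f, HK f &
      (fun n => Num.sqrt (ip (u n \- f) (u n \- f))) @ \oo --> (0 : R);
  rkhs_reproducing : forall f x, HK f -> ip f (K x) = f x }.

End RKHS.

Section Randomness.
Variables (R : realType) (dO : measure_display) (Omega : measurableType dO).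
Variable Pr : probability Omega R.

Definition borel (T : topologicalType) : set (set T) := <<s @open T >>.

Definition random_element (T : topologicalType) (X : Omega -> T) : Prop :=
  forall A, borel A -> measurable (X @^-1` A).

Definition independent (T : topologicalType) (N : nat)
    (X : 'I_N -> Omega -> T) : Prop :=
  forall A : 'I_N -> set T, (forall i, borel (A i)) ->
    fine (Pr (\bigcap_(i in [set: 'I_N]) (X i @^-1` A i))) =
    \prod_(i < N) fine (Pr (X i @^-1` A i)).

Definition iid (T : topologicalType) (N : nat) (X : 'I_N -> Omega -> T) :
    Prop :=
  [/\ forall i, random_element (X i),
      forall i j A, borel A -> Pr (X i @^-1` A) = Pr (X j @^-1` A) &
      independent X].

Definition bounded_field (P : atlas R) (g : metric P)
    (u : forall z : P, tspace z) : Prop :=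
  (forall A, @borel (tangent P) A ->
     @borel P ((fun z => tpoint (u z)) @^-1` A)) /\
  exists b : R, forall z, g z (u z) (u z) <= b.

(* Given the base point Z, the tangent vector eps has mean 0 and covariance
   sigma^2 I_d with respect to g. As eps lives in the random vector space T_Z P,
   the conditional moments are tested against vector fields. *)
Definition centered_noise (P : atlas R) (g : metric P) (sigma : R)
    (Z : Omega -> P) (eps : forall w, tspace (Z w)) : Prop :=
  [/\ Pr.-integrable setT (fun w => (g (Z w) (eps w) (eps w))%:E),
      forall u, bounded_field g u ->
        ('E_Pr[fun w => g (Z w) (eps w) (u (Z w))] = 0)%E &
      forall u v, bounded_field g u -> bounded_field g v ->
        ('E_Pr[fun w => (g (Z w) (eps w) (u (Z w)) * g (Z w) (eps w) (v (Z w)))%R] =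
         (sigma ^+ 2)%:E * 'E_Pr[fun w => g (Z w) (u (Z w)) (v (Z w))])%E].

End Randomness.

Section Estimator.
Variables (R : realType) (P : atlas R) (g : metric P) (Bsharp : bundle_map P).
Variables (N : nat) (ZN : 'I_N -> P).

Definition tspaceN : Type := forall i : 'I_N, tspace (ZN i).

Definition gN (u v : tspaceN) : R := \sum_(i < N) g (u i) (v i).

Definition hamiltonianN (h : P -> R) : tspaceN :=
  fun i => hamiltonian Bsharp h (ZN i).

Definition kernel_expansion (K : P -> P -> R) (c : tspaceN) : P -> R :=
  fun y => gN c (hamiltonianN (K y)).

Definition gram (K : P -> P -> R) (c : tspaceN) : tspaceN :=
  hamiltonianN (kernel_expansion K c).

Definition regularized_gram (K : P -> P -> R) (lambda : R) (c : tspaceN) :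
    tspaceN :=
  fun i => gram K c i + (lambda * N%:R) *: c i.

Definition objective (ip : (P -> R) -> (P -> R) -> R) (lambda : R)
    (XN : tspaceN) (h : P -> R) : R :=
  N%:R^-1 * (\sum_(i < N) gnorm g (hamiltonianN h i - XN i) ^+ 2)
  + lambda * ip h h.

End Estimator.

Definition unique_argmin (R : realType) (T : Type) (D : set T) (E : T -> R)
    (h : T) : Prop :=
  [/\ D h, forall h', D h' -> E h <= E h' &
      forall h', D h' -> (forall h'', D h'' -> E h' <= E h'') -> h' = h].

(* Main.v *)
(* The kernel k(u, v) read in a chart is C^2, so the mixed second difference of
   the feature map Phi(u) = K_{psi u} satisfies
     <Phi(p+a) - Phi(p), Phi(p+b) - Phi(p)> = M(a, b) + o(|a||b|),
   with M the mixed Hessian of k. Completeness of the RKHS then makes Phi Frechet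
   differentiable at p, and the reproducing property passes to derivatives:
   df(z) v = <f, L v> with L v in the RKHS. Hence h |-> X_h(Z_N) has the adjoint
   c |-> g_N(c, X_{K_.}(Z_N)), the Gram map is A A^*, which is positive
   semidefinite, so A A^* + lambda N is invertible, and completing the square in
   the ridge functional shows that A^* c is its only minimizer. *)
Require Import Defs.
From HB Require Import structures.
From mathcomp Require Import all_boot all_order all_algebra.
From mathcomp Require Import all_classical all_reals all_analysis.
From mathcomp Require Import ring lra.
Set Implicit Arguments.
Unset Strict Implicit.
Unset Printing Implicit Defensive.
Import Order.TTheory GRing.Theory Num.Theory.
Import numFieldNormedType.Exports.
Local Open Scope classical_set_scope.
Local Open Scope ring_scope.

(** * Second differences of C^2 functions *)

Lemma is_derive_line (R : realType) (V : normedModType R) (f : V -> R)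
    (x v : V) (s : R) : differentiable f (x + s *: v) ->
  is_derive s 1 (fun s : R => f (x + s *: v)) ('d f (x + s *: v) v).
Proof.
move=> df.
have dl : is_diff (s : R^o) (fun s : R^o => x + s *: v) (fun s : R^o => s *: v).
  have := is_diffD (is_diff_cst x (s : R^o)) (is_diff_scalel s v).
  by rewrite add0r.
have dfP := differentiableP df.
have dg := @is_diff_comp R R^o V R^o _ _ _ _ s dl dfP.
have dgd := @ex_diff _ _ _ _ _ _ _ dg.
split.
  by apply/derivable1_diffP.
by rewrite deriveE // (diff_val) /= scale1r.
Qed.

Lemma MVT01 (R : realType) (f df : R -> R) :
  (forall t : R, 0 <= t <= 1 -> is_derive t 1 f (df t)) ->
  exists2 t : R, 0 <= t <= 1 & f 1 - f 0 = df t.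
Proof.
move=> fdf; have [t||t] := @MVT_segment R f df 0 1 ler01.
- by rewrite in_itv /= => /andP[/ltW t0 /ltW t1]; apply: fdf; rewrite t0 t1.
- apply: derivable_within_continuous => t; rewrite in_itv /= => t01.
  by have [] := fdf _ t01.
- by rewrite in_itv /= subr0 mulr1; exists t.
Qed.

(** Two mean value theorems: one along [a] for the increment of [f] by [b], which fixes [s], then
    one along [b] for the derivative of [f] in direction [a], which fixes [t]. *)
Lemma second_difference (R : realType) (V : normedModType R) (U : set V)
    (f : V -> R) (x a b : V) : @Ck R V R^o 2 U f ->
  (forall s t : R, 0 <= s <= 1 -> 0 <= t <= 1 -> U (x + s *: a + t *: b)) ->
  exists s t : R, [/\ 0 <= s <= 1, 0 <= t <= 1 &
    f (x + a + b) - f (x + a) - f (x + b) + f x =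
    'd (fun y => 'd f y a : R^o) (x + s *: a + t *: b) b].
Proof.
move=> [df d2f] xU.
have e0 : (0 : R) <= (0 : R) <= (1 : R) by rewrite le_refl ler01.
have e1 : (0 : R) <= (1 : R) <= (1 : R) by rewrite ler01 le_refl.
have [|s s01 Es] := @MVT01 R
    (fun s => f (x + b + s *: a) - f (x + s *: a))
    (fun s => 'd f (x + b + s *: a) a - 'd f (x + s *: a) a).
  move=> s s01; apply: is_deriveB; apply: is_derive_line; apply: df.
    by have := xU s 1 s01 e1; rewrite scale1r addrAC.
  by have := xU s 0 s01 e0; rewrite scale0r addr0.
have [|t t01 Et] := @MVT01 R (fun t => 'd f (x + s *: a + t *: b) a)
    (fun t => 'd (fun y => 'd f y a : R^o) (x + s *: a + t *: b) b).
  move=> t t01; apply: (@is_derive_line R V (fun y => 'd f y a)).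
  by have [+ _] := d2f a; apply; exact: xU.
exists s, t; split => //.
rewrite -{}Et !scale1r !scale0r !addr0 (addrAC x (s *: a) b) -{}Es.
by rewrite !scale1r !scale0r !addr0 (addrAC x b a); ring.
Qed.

(** The norm of a row vector is the largest absolute value of its coordinates, so each of the
    [m ^ 2] terms of the expansion in the standard basis is at most [|a| * |b| * c]. *)
Lemma bilinear_bound (R : realType) (m : nat) (M : 'rV[R]_m -> 'rV[R]_m -> R)
    (c : R) : 0 <= c ->
  (forall b, scalar (M ^~ b)) -> (forall a, scalar (M a)) ->
  (forall i j, `|M (delta_mx 0 i) (delta_mx 0 j)| <= c) ->
  forall a b, `|M a b| <= m%:R ^+ 2 * c * `|a| * `|b|.
Proof.
move=> c0 Ml Mr Mc a b.
pose l b : {scalar 'rV[R]_m} :=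
  HB.pack (M ^~ b) (GRing.isLinear.Build _ _ _ _ _ (Ml b)).
pose r a : {scalar 'rV[R]_m} :=
  HB.pack (M a) (GRing.isLinear.Build _ _ _ _ _ (Mr a)).
have coordle (u : 'rV[R]_m) i : `|u 0 i| <= `|u|.
  rewrite [leRHS]mx_normrE; exact: (le_bigmax _ (fun ij => `|u ij.1 ij.2|) (0, i)).
have -> : M a b = \sum_i \sum_j a 0 i * b 0 j * M (delta_mx 0 i) (delta_mx 0 j).
  rewrite -[M a b]/(l b a) [in LHS](row_sum_delta a) linear_sum.
  apply: eq_bigr => i _; rewrite linearZ /= -[M _ b]/(r _ b) [in LHS](row_sum_delta b) linear_sum mulr_sumr.
  by apply: eq_bigr => j _; rewrite linearZ /= mulrA.
have -> : m%:R ^+ 2 * c * `|a| * `|b| = \sum_(i < m) \sum_(j < m) `|a| * `|b| * c.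
  by rewrite !sumr_const !card_ord -mulrnA -[RHS]mulr_natr natrM; ring.
do 2 (apply: le_trans (ler_norm_sum _ _ _) _; apply: ler_sum => ? _).
by rewrite !normrM; apply: ler_pM; rewrite ?mulr_ge0 ?ler_pM.
Qed.

(** Linearity in [b] is built into the differential. Linearity in the inner direction [a] rests on
    each directional derivative of [f] being differentiable at [x]. *)
Lemma second_derivative_scalar (R : realType) (V : normedModType R) (U : set V)
    (f : V -> R) (x b : V) : @Ck R V R^o 2 U f -> U x ->
  scalar (fun a => 'd (fun y => 'd f y a : R^o) x b).
Proof.
move=> [_ d2f] Ux k a a' /=.
have dfa v : differentiable (fun y => 'd f y v : R^o) x by have [+ _] := d2f v; apply.
have dF := dfa a; have dF' := dfa a'.
have : (fun y => 'd f y (k *: a + a') : R^o) =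
    k *: (fun y => 'd f y a : R^o) + (fun y => 'd f y a' : R^o).
  by apply/funext => y; rewrite linearP.
move: (fun y => 'd f y a : R^o) (fun y => 'd f y a' : R^o) dF dF' => F F' dF dF' ->.
have EZ : 'd (k *: F) x b = k *: 'd F x b by exact: (congr1 (@^~ b) (diffZ k dF)).
exact: etrans (congr1 (@^~ b) (diffD (differentiableZ k dF) dF'))
  (congr1 (fun z => z + 'd F' x b) EZ).
Qed.

(** The second difference is a mixed derivative at a nearby point, and the finitely many basis
    entries of the Hessian are continuous at [x]. The error is a product in [a] and [b], not a sum
    of squares, so both increments can later be rescaled independently. *)
Lemma second_difference_littleo (R : realType) (m : nat) (U : set 'rV[R]_m)
    (f : 'rV[R]_m -> R) (x : 'rV[R]_m) : open U -> U x ->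
    @Ck R _ R^o 2 U f ->
  forall e : R, 0 < e -> exists2 d : R, 0 < d & forall a b : 'rV[R]_m,
    `|a| < d -> `|b| < d ->
    `|f (x + a + b) - f (x + a) - f (x + b) + f x
       - 'd (fun y => 'd f y a : R^o) x b| <= e * `|a| * `|b|.
Proof.
move=> Uo Ux fC2 e e0.
pose M (y a b : 'rV[R]_m) : R := 'd (fun y => 'd f y a : R^o) y b.
(* Entries within [c] give a bilinear error with constant [m ^ 2 * c <= e]; the [+ 1] covers
   [m = 0]. *)
pose c := e / (m%:R ^+ 2 + 1).
have m0 : 0 < m%:R ^+ 2 + 1 :> R by rewrite ltr_wpDl// exprn_ge0.
have c0 : 0 < c by rewrite divr_gt0.
have : \forall y \near x, U y /\ forall i j,
    `|M x (delta_mx 0 i) (delta_mx 0 j) - M y (delta_mx 0 i) (delta_mx 0 j)| <= c.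
  apply: filterI; first exact: open_nbhs_nbhs.
  suff dM i j : nbhs x [set y |
      `|M x (delta_mx 0 i) (delta_mx 0 j) - M y (delta_mx 0 i) (delta_mx 0 j)| <= c].
    exact: filter_forall (fun i => filter_forall _ (dM i)).
  have [_ /(_ (delta_mx 0 i)) [_ /(_ (delta_mx 0 j)) /(_ x Ux)]] := fC2.
  by move=> /cvgrPdist_le /(_ c c0).
move=> /nbhs_ballP [d /= d0 xd].
(* Half of [d] for each increment keeps the whole parallelogram in the ball of radius [d]. *)
exists (d / 2) => [|a b ad bd]; first by rewrite divr_gt0.
have xdP s t : 0 <= s <= 1 -> 0 <= t <= 1 -> ball x d (x + s *: a + t *: b).
  move=> /andP[s0 s1] /andP[t0 t1]; rewrite -ball_normE /ball_ /=.
  rewrite -addrA opprD addNKr normrN (splitr d).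
  rewrite (le_lt_trans (ler_normD _ _))// ltrD// normrZ ger0_norm//.
    by rewrite (le_lt_trans _ ad)// ler_piMl.
  by rewrite (le_lt_trans _ bd)// ler_piMl.
have [s [t [s01 t01 ->]]] :=
  second_difference fC2 (fun s t s01 t01 => (xd _ (xdP s t s01 t01)).1).
have [Uy Ey] := xd _ (xdP s t s01 t01).
set y := x + s *: a + t *: b in Uy Ey *.
rewrite distrC; change (`|M x a b - M y a b| <= e * `|a| * `|b|).
have := @bilinear_bound R m (fun a b => M x a b - M y a b) c (ltW c0) _ _ Ey a b.
have Mlx v : scalar (M x ^~ v) := second_derivative_scalar v fC2 Ux.
have Mly v : scalar (M y ^~ v) := second_derivative_scalar v fC2 Uy.
have Mr y' u : scalar (M y' u) := linearP ('d (fun y => 'd f y u : R^o) y').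
have Mrx := Mr x; have Mry := Mr y.
clearbody y.
move: (M x) (M y) Mlx Mly Mrx Mry => Mx My Mlx Mly Mrx Mry.
move=> /(_ _ _)/le_trans; apply.
- by move=> v k u u' /=; rewrite Mlx Mly /=; ring.
- by move=> u k v v' /=; rewrite Mrx Mry /=; ring.
rewrite ler_wpM2r// ler_wpM2r// /c mulrCA ler_piMr// ?ltW//.
by rewrite ltr_pdivrMr// mul1r ltrDl.
Qed.

(** * Inner product algebra in a reproducing kernel Hilbert space *)

Section ReproducingKernel.
Variables (R : realType) (T : Type) (K : T -> T -> R) (HK : set (T -> R)).
Variables (ip : (T -> R) -> (T -> R) -> R).
Hypothesis hHK : rkhs K HK ip.
Implicit Types (f h : T -> R).

(** When [T] is empty, [rkhs] allows [HK] to be empty; zero is therefore built from a given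
    element. *)
Lemma rkhs0 f : HK f -> HK 0.
Proof.
move=> Hf; have := rkhs_linear hHK (-1) Hf Hf.
by rewrite -[X in HK X]/(-1 *: f + f) scaleN1r addNr.
Qed.

Lemma rkhsZ (a : R) f : HK f -> HK (a *: f).
Proof.
move=> Hf; have := rkhs_linear hHK a Hf (rkhs0 Hf).
by rewrite -[X in HK X]/(a *: f + 0) addr0.
Qed.

Lemma rkhsD f h : HK f -> HK h -> HK (f + h).
Proof.
move=> Hf Hh; have := rkhs_linear hHK 1 Hf Hh.
by rewrite -[X in HK X]/(1 *: f + h) scale1r.
Qed.

Lemma rkhsB f h : HK f -> HK h -> HK (f - h).
Proof. by move=> Hf Hh; rewrite -scaleN1r; apply: rkhsD => //; exact: rkhsZ. Qed.

Lemma ipZDl (a : R) f f' h : HK f -> HK f' -> HK h ->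
  ip (a *: f + f') h = a * ip f h + ip f' h.
Proof. by move=> Hf Hf' Hh; have := rkhs_ip_linear hHK a Hf Hf' Hh. Qed.

Lemma ip0l h : HK h -> ip 0 h = 0.
Proof.
move=> Hh; have H0 := rkhs0 Hh.
by have := ipZDl (-1) H0 H0 Hh; rewrite scaleN1r oppr0 addr0 mulN1r addNr.
Qed.

Lemma ipZl (a : R) f h : HK f -> HK h -> ip (a *: f) h = a * ip f h.
Proof.
by move=> Hf Hh; have := ipZDl a Hf (rkhs0 Hf) Hh; rewrite addr0 ip0l ?addr0.
Qed.

Lemma ipDl f f' h : HK f -> HK f' -> HK h -> ip (f + f') h = ip f h + ip f' h.
Proof. by move=> Hf Hf' Hh; have := ipZDl 1 Hf Hf' Hh; rewrite scale1r mul1r. Qed.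

Lemma ipBl f f' h : HK f -> HK f' -> HK h -> ip (f - f') h = ip f h - ip f' h.
Proof.
move=> Hf Hf' Hh; rewrite -scaleN1r ipDl ?ipZl ?mulN1r//; exact: rkhsZ.
Qed.

Lemma ip_sym f h : HK f -> HK h -> ip f h = ip h f.
Proof. exact: (rkhs_ip_sym hHK). Qed.

Lemma ipZr (a : R) f h : HK f -> HK h -> ip h (a *: f) = a * ip h f.
Proof. by move=> Hf Hh; rewrite ip_sym ?ipZl ?(ip_sym Hf)//; exact: rkhsZ. Qed.

Lemma ipDr f f' h : HK f -> HK f' -> HK h -> ip h (f + f') = ip h f + ip h f'.
Proof.
by move=> Hf Hf' Hh; rewrite ip_sym ?ipDl ?(ip_sym Hh)//; exact: rkhsD.
Qed.

Lemma ipBr f f' h : HK f -> HK f' -> HK h -> ip h (f - f') = ip h f - ip h f'.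
Proof.
by move=> Hf Hf' Hh; rewrite ip_sym ?ipBl ?(ip_sym Hh)//; exact: rkhsB.
Qed.

Lemma rkhs_sum (I : finType) (F : I -> T -> R) f : HK f ->
  (forall i, HK (F i)) -> HK (\sum_i F i).
Proof.
by move=> Hf HF; apply: big_ind => //; [exact: rkhs0 Hf | exact: rkhsD].
Qed.

Lemma ip_sumr (I : finType) (F : I -> T -> R) h : HK h -> (forall i, HK (F i)) ->
  ip h (\sum_i F i) = \sum_i ip h (F i).
Proof.
move=> Hh HF.
(* [ip] is linear only on [HK], so the induction carries membership along with the value. *)
pose Q (f : T -> R) (r : R) := HK f /\ ip h f = r.
suff [] : Q (\sum_i F i) (\sum_i ip h (F i)) by [].
apply: (big_ind2 Q) => [|f r f' r' [Hf <-] [Hf' <-]|i _]; last by split.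
  by split; [exact: rkhs0 Hh | rewrite (ip_sym Hh (rkhs0 Hh)) ip0l].
by split; [exact: rkhsD | rewrite ipDr].
Qed.

Lemma ip_eq0 f : HK f -> ip f f = 0 -> f = 0.
Proof. by move=> Hf f0; apply/funext => x; exact: (rkhs_ip_eq0 hHK Hf f0 x). Qed.

Lemma cauchy_schwarz f h : HK f -> HK h -> ip f h ^+ 2 <= ip f f * ip h h.
Proof.
move=> Hf Hh; have [h0|h0] := eqVneq (ip h h) 0.
  by rewrite (ip_eq0 Hh h0) (ip_sym Hf (rkhs0 Hf)) !ip0l ?expr0n/= ?mulr0//;
    exact: rkhs0 Hf.
have hh : 0 < ip h h by rewrite lt_def h0 (rkhs_ip_ge0 hHK Hh).
pose t := ip f h / ip h h.
have Hth := rkhsZ t Hh.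
have := rkhs_ip_ge0 hHK (rkhsB Hf Hth).
rewrite ipBl ?ipBr ?ipZl ?ipZr// ?ipZl//; last exact: rkhsB.
rewrite (ip_sym Hh Hf).
have -> : ip f f - t * ip f h - (t * ip f h - t * (t * ip h h)) =
    (ip f f * ip h h - ip f h ^+ 2) / ip h h by rewrite /t; field.
by rewrite pmulr_lge0 ?invr_gt0// subr_ge0.
Qed.

(** Norm convergence implies weak convergence, by Cauchy-Schwarz. *)
Lemma cvg_ip (u : nat -> T -> R) f h : (forall n, HK (u n)) -> HK f -> HK h ->
  (fun n => Num.sqrt (ip (u n \- f) (u n \- f))) @ \oo --> (0 : R) ->
  (fun n => ip h (u n)) @ \oo --> ip h f.
Proof.
move=> Hu Hf Hh uf; apply/cvgrPdist_lt => e e0.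
(* The [+ 1] keeps the divisor positive when [h] is zero. *)
have c0 : 0 < Num.sqrt (ip h h) + 1 by rewrite ltr_wpDl.
move/cvgr0Pnorm_lt : uf => /(_ (e / (Num.sqrt (ip h h) + 1))).
rewrite divr_gt0// => /(_ isT); apply: filterS => n.
rewrite ger0_norm ?sqrtr_ge0//.
rewrite -[X in ip X _]/(u n - f) -[X in ip _ X]/(u n - f) => unf.
rewrite distrC -ipBr// -sqrtr_sqr.
have Huf := rkhsB (Hu n) Hf.
apply: (@le_lt_trans _ _ (Num.sqrt (ip h h) * Num.sqrt (ip (u n - f) (u n - f)))).
  rewrite -sqrtrM ?(rkhs_ip_ge0 hHK Hh)//; apply: ler_wsqrtr; exact: cauchy_schwarz.
rewrite -(@divfK _ (Num.sqrt (ip h h) + 1) _ e) ?gt_eqF// mulrC.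
apply: (@le_lt_trans _ _
  (Num.sqrt (ip (u n - f) (u n - f)) * (Num.sqrt (ip h h) + 1))).
  by rewrite ler_wpM2l ?sqrtr_ge0// lerDl.
by rewrite ltr_pM2r.
Qed.

End ReproducingKernel.

(** * Differentiability of the feature map *)

Section FeatureMap.
Variables (R : realType) (T : Type) (K : T -> T -> R) (HK : set (T -> R)).
Variables (ip : (T -> R) -> (T -> R) -> R).
Hypothesis hHK : rkhs K HK ip.
Variables (V : normedModType R) (psi : V -> T) (p : V) (M : V -> V -> R).
Hypotheses (M_linear_l : forall b, scalar (M ^~ b))
  (M_linear_r : forall a, scalar (M a)).

Let k (a b : V) : R := K (psi (p + a)) (psi (p + b)).

Hypothesis mixed_difference : forall e : R, 0 < e ->
  exists2 d : R, 0 < d & forall a b : V, `|a| < d -> `|b| < d ->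
    `|k a b - k a 0 - k 0 b + k 0 0 - M a b| <= e * `|a| * `|b|.

(** Increment of the feature map at [p]: by the reproducing property, the second difference in
    [mixed_difference] is [ip (Phi a) (Phi b)]. *)
Let Phi (a : V) : T -> R := K (psi (p + a)) - K (psi p).

Let PhiE a x : Phi a x = K (psi (p + a)) x - K (psi p) x. Proof. by []. Qed.

Let HPhi a : HK (Phi a).
Proof. by apply: (rkhsB hHK); exact: (rkhs_kernel hHK). Qed.

Let ip_Phi f a : HK f -> ip f (Phi a) = f (psi (p + a)) - f (psi p).
Proof.
move=> Hf; rewrite (ipBr hHK)//; try exact: (rkhs_kernel hHK).
by rewrite !(rkhs_reproducing hHK).
Qed.

Let MZl (t : R) a b : M (t *: a) b = t * M a b.
Proof.
have M0 : M 0 b = 0.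
  by have := M_linear_l b (-1) 0 0; rewrite scaler0 addr0 /= mulN1r addNr.
by have := M_linear_l b t a 0; rewrite /= M0 !addr0.
Qed.

Let MZr (t : R) a b : M a (t *: b) = t * M a b.
Proof.
have M0 : M a 0 = 0.
  by have := M_linear_r a (-1) 0 0; rewrite scaler0 addr0 /= mulN1r addNr.
by have := M_linear_r a t b 0; rewrite /= M0 !addr0.
Qed.

(** The error allowed by [mixed_difference] scales like [|s * t|], so dividing each slot by its own
    step leaves a bound free of both steps. *)
Let ip_Phi_near (e : R) : 0 < e -> exists2 d : R, 0 < d &
  forall (s t : R) a b, s != 0 -> t != 0 -> `|s *: a| < d -> `|t *: b| < d ->
  `|ip (s^-1 *: Phi (s *: a)) (t^-1 *: Phi (t *: b)) - M a b| <= e * `|a| * `|b|.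
Proof.
move=> /mixed_difference [d d0 kM]; exists d => // s t a b s0 t0 ad bd.
have HZ := rkhsZ hHK; rewrite (ipZl hHK) ?(ipZr hHK)//; last exact: HZ.
rewrite ip_Phi// !PhiE.
have := kM _ _ ad bd; rewrite /k !addr0 MZl MZr !normrZ.
set D := (X in `|X - _| <= _) => DM.
have -> : s^-1 * (t^-1 * (K (psi (p + s *: a)) (psi (p + t *: b)) -
     K (psi p) (psi (p + t *: b)) - (K (psi (p + s *: a)) (psi p) - K (psi p) (psi p))))
   - M a b = (D - s * (t * M a b)) / (s * t).
  by rewrite /D; field; rewrite s0 t0.
rewrite normrM normfV ler_pdivrMr ?normr_gt0 ?mulf_neq0//.
by apply: le_trans DM _; rewrite normrM le_eqVlt; apply/orP; left; apply/eqP; ring.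
Qed.

Let tn (n : nat) : R := n.+1%:R^-1.

Let tn_neq0 n : tn n != 0. Proof. by rewrite invr_eq0 pnatr_eq0. Qed.

Let tn_small (d : R) (v : V) : 0 < d ->
  exists n0, forall n, (n0 <= n)%N -> `|tn n *: v| < d.
Proof.
(* [n.+1] exceeds [|v| / d] as soon as [n] reaches the integer part of that quotient. *)
move=> d0; exists (Num.truncn (`|v| / d)) => n n0n.
rewrite normrZ /tn ger0_norm ?invr_ge0// mulrC ltr_pdivrMr ?ltr0Sn//.
rewrite mulrC -ltr_pdivrMr//.
by apply: lt_le_trans (truncnS_gt _) _; rewrite ler_nat ltnS.
Qed.

Let u (v : V) n : T -> R := (tn n)^-1 *: Phi (tn n *: v).

Let Hu v n : HK (u v n). Proof. exact: (rkhsZ hHK). Qed.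

(** The difference quotients [u v n] are Cauchy: the squared norm of [u v m - u v n] expands into
    four inner products, all close to [M v v], whose leading parts cancel. Only weak convergence to
    the limit is kept. *)
Let derivative_ex (v : V) : exists L, HK L /\
  forall h, HK h -> (fun n => ip h (u v n)) @ \oo --> ip h L.
Proof.
have [|L HL uL] := rkhs_complete hHK (Hu v).
  (* With this [e'], the four errors [e' * |v| ^ 2] add up to less than [e ^ 2], also when
     [v = 0]. *)
  move=> e e0; pose e' := e ^+ 2 / (4 * (`|v| ^+ 2 + 1)).
  have c0 : 0 < 4 * (`|v| ^+ 2 + 1) by rewrite mulr_gt0// ltr_wpDl// exprn_ge0.
  have e'0 : 0 < e' by rewrite divr_gt0// exprn_gt0.
  have [d d0 /= dM] := ip_Phi_near e'0; have [n0 n0P] := tn_small v d0.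
  exists n0 => m n mn0 nn0.
  rewrite -[X in ip X _]/(u v m - u v n) -[X in ip _ X]/(u v m - u v n).
  rewrite -[ltRHS]ger0_norm ?ltW// -[ltRHS]sqrtr_sqr ltr_sqrt ?exprn_gt0//.
  rewrite (ipBl hHK) ?(ipBr hHK)//; last exact: (rkhsB hHK).
  have := dM _ _ v v (tn_neq0 m) (tn_neq0 m) (n0P _ mn0) (n0P _ mn0).
  have := dM _ _ v v (tn_neq0 m) (tn_neq0 n) (n0P _ mn0) (n0P _ nn0).
  have := dM _ _ v v (tn_neq0 n) (tn_neq0 m) (n0P _ nn0) (n0P _ mn0).
  have := dM _ _ v v (tn_neq0 n) (tn_neq0 n) (n0P _ nn0) (n0P _ nn0).
  rewrite -!/(u _ _) !ler_norml.
  have : 4 * (e' * `|v| * `|v|) < e ^+ 2.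
    rewrite -[ltRHS]mul1r.
    have -> : 4 * (e' * `|v| * `|v|) =
      (`|v| ^+ 2 / (`|v| ^+ 2 + 1)) * e ^+ 2.
      by rewrite /e'; field; rewrite gt_eqF// ltr_wpDl// exprn_ge0.
    rewrite ltr_pM2r ?exprn_gt0// ltr_pdivrMr ?ltr_wpDl ?exprn_ge0//.
    by rewrite mul1r ltrDl.
  by lra.
by exists L; split => // h Hh; exact: (cvg_ip hHK).
Qed.

(** [L v] is the derivative of the feature map in direction [v]. By Cauchy-Schwarz, the last clause
    reduces to the norm of [Phi a - L a] being [o(|a|)]. *)
Lemma feature_map_differentiable : exists L : V -> T -> R,
  [/\ forall v, HK (L v),
      forall f, HK f -> scalar (fun v => ip f (L v)) &
      forall f (e : R), HK f -> 0 < e -> exists2 d : R, 0 < d & forall a, `|a| < d ->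
        `|f (psi (p + a)) - f (psi p) - ip f (L a)| <= e * `|a| ].
Proof.
have [L HL] := choice derivative_ex.
have HLv v : HK (L v) by have [] := HL v.
have uL v h : HK h -> (fun n => ip h (u v n)) @ \oo --> ip h (L v).
  by have [_] := HL v; apply.
(* Bounds on difference quotients pass to the limit: in one slot for [L_near], then in the other for
   [L_ip]. *)
have lim_le v h (x c : R) n0 : HK h ->
    (forall n, (n0 <= n)%N -> `|ip h (u v n) - x| <= c) -> `|ip h (L v) - x| <= c.
  move=> Hh hx.
  have hu : `|ip h (u v n) - x| @[n --> \oo] --> `|ip h (L v) - x|.
    exact: cvg_norm (cvgB (uL v h Hh) (cvg_cst x)).
  have hc : \forall n \near \oo, `|ip h (u v n) - x| <= c by exists n0.
  exact: (cvgr_to_le hu hc).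
have L_near (e : R) : 0 < e -> exists2 d : R, 0 < d &
    forall (t : R) v b, t != 0 -> `|t *: b| < d ->
    `|ip (t^-1 *: Phi (t *: b)) (L v) - M v b| <= e * `|v| * `|b|.
  move=> /ip_Phi_near [d d0 dM]; exists d => // t v b t0 tb.
  have [n0 n0P] := tn_small v d0.
  have Hb := rkhsZ hHK t^-1 (HPhi (t *: b)).
  apply: (lim_le v _ _ _ n0 Hb) => n nn0.
  by rewrite (ip_sym hHK)//; apply: dM => //; exact: n0P nn0.
(* [L_near] holds for every tolerance, so in the limit the Gram form of [L] is exactly [M]. *)
have L_ip v w : ip (L v) (L w) = M v w.
  apply/eqP; rewrite -subr_eq0 -normr_le0; apply/ler_addgt0Pr => e e0.
  rewrite add0r; have c0 : 0 < `|v| * `|w| + 1 by rewrite ltr_wpDl// mulr_ge0.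
  have [d d0 dM] := L_near _ (divr_gt0 e0 c0); have [n0 n0P] := tn_small w d0.
  apply: (lim_le w _ _ _ n0 (HLv v)) => n nn0; rewrite (ip_sym hHK)//.
  apply: le_trans (dM _ v w (tn_neq0 n) (n0P n nn0)) _.
  rewrite -mulrA -mulrA ler_piMr ?ltW// mulrC ltr_pdivrMr// mul1r ltrDl //.
have HZD a v w : HK (a *: L v + L w) by apply: (rkhsD hHK) => //; exact: (rkhsZ hHK).
(* The defect of linearity is orthogonal to every value of [L], because [M] is linear on the left.
   Being itself a combination of such values, it is orthogonal to itself. *)
have L_lin a v w : L (a *: v + w) = a *: L v + L w.
  apply: subr0_eq; have HX := rkhsB hHK (HLv (a *: v + w)) (HZD a v w).
  apply: (ip_eq0 hHK) => //.
  set X := (X in HK X) in HX; change (ip X (L (a *: v + w) - (a *: L v + L w)) = 0).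
  suff X0 x : ip X (L x) = 0.
    rewrite (ipBr hHK)// (ipDr hHK)// ?(ipZr hHK)// ?X0 ?mulr0 ?addr0 ?subr0//.
    exact: (rkhsZ hHK).
  rewrite /X (ipBl hHK)// (ipZDl hHK)// !L_ip.
  by rewrite M_linear_l subrr.
exists L; split=> [//|f Hf a v w|f e Hf e0].
  by rewrite L_lin (ipDr hHK) ?(ipZr hHK)//; exact: (rkhsZ hHK).
have f0 := rkhs_ip_ge0 hHK Hf.
(* In the squared norm of [Phi a - L a], the product of [Phi a] with itself errs once and that with
   [L a] twice, each by at most [e' * |a| ^ 2]; the factor 4 covers this. Cauchy-Schwarz contributes
   [ip f f]. *)
pose e' := e ^+ 2 / (4 * (ip f f + 1)).
have c0 : 0 < 4 * (ip f f + 1) by rewrite mulr_gt0// ltr_wpDl.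
have e'0 : 0 < e' by rewrite divr_gt0// exprn_gt0.
have [d d0 dM] := ip_Phi_near e'0; have [d' d'0 dM'] := L_near _ e'0.
exists (Num.min d d') => [|a]; first by rewrite lt_min d0.
rewrite lt_min => /andP[ad ad'].
have Hd := rkhsB hHK (HPhi a) (HLv a).
rewrite -ip_Phi// -(ipBr hHK)//.
rewrite -[leRHS]ger0_norm ?mulr_ge0 ?(ltW e0)// -ler_sqr ?nnegrE//.
rewrite -!normrX !ger0_norm ?sqr_ge0//.
apply: le_trans (cauchy_schwarz hHK Hf Hd) _.
rewrite (ipBl hHK (HPhi a) (HLv a) Hd).
rewrite (ipBr hHK (HPhi a) (HLv a) (HPhi a)) (ipBr hHK (HPhi a) (HLv a) (HLv a)).
rewrite L_ip (ip_sym hHK (HLv a) (HPhi a)).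
(* Unit steps turn the estimates on quotients into estimates on [Phi a] itself. *)
have := dM 1 1 a a (oner_neq0 R) (oner_neq0 R).
have := dM' 1 a a (oner_neq0 R).
rewrite !scale1r invr1 !scale1r => /(_ ad') h1 /(_ ad ad); move: h1.
rewrite !ler_norml => /andP[h1 h2] /andP[h3 h4].
apply: (@le_trans _ _ (ip f f * (4 * (e' * `|a| * `|a|)))).
  by rewrite ler_wpM2l//; lra.
have -> : ip f f * (4 * (e' * `|a| * `|a|)) =
    (ip f f / (ip f f + 1)) * (e * `|a|) ^+ 2.
  by rewrite /e'; field; rewrite gt_eqF// ltr_wpDl.
by rewrite ler_piMl ?sqr_ge0// ler_pdivrMr ?ltr_wpDl// mul1r lerDl.
Qed.

End FeatureMap.

(** * Differentials of RKHS elements on the manifold *)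

Lemma CkS (R : realType) (V W : normedModType R) (k : nat) (U : set V)
  (f : V -> W) : Ck k.+1 U f -> Ck k U f.
Proof.
elim: k f => [|k IH] f [df d2f].
  by move=> x Ux; apply: differentiable_continuous; exact: df.
by split => // v; apply: IH; exact: d2f.
Qed.

Lemma scalar_rV_continuous (R : realType) (n : nat) (l : 'rV[R]_n -> R^o)
  (l_lin : scalar l) : continuous l.
Proof.
pose f : {linear 'rV[R]_n -> R^o} :=
  HB.pack l (GRing.isLinear.Build R 'rV[R]_n R^o *:%R l l_lin).
have lE : l = \sum_(j < n) (fun v : 'rV[R]_n => l (delta_mx 0 j) *: (v 0 j : R^o)).
  apply/funext => v; rewrite -[l v]/(f v) {1}(row_sum_delta v) linear_sum fct_sumE.
  by apply: eq_bigr => j _; rewrite linearZ; exact: mulrC.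
rewrite lE => v; apply: differentiable_continuous; apply: differentiable_sum => j.
by apply: differentiableZ; exact: differentiable_coord.
Qed.

(** Turns an epsilon-delta estimate into a differential; the candidate [l] is continuous as a
    combination of coordinates. *)
Lemma differentiable_littleo (R : realType) (n : nat) (f : 'rV[R]_n -> R^o)
    (p : 'rV[R]_n) (l : 'rV[R]_n -> R) : scalar l ->
  (forall e : R, 0 < e -> exists2 d : R, 0 < d & forall a, `|a| < d ->
     `|f (p + a) - f p - l a| <= e * `|a|) ->
  differentiable f p /\ 'd f p = l :> (_ -> _).
Proof.
move=> l_lin fl; have lc := scalar_rV_continuous l_lin.
pose df : {linear 'rV[R]_n -> R^o} :=
  HB.pack (l : _ -> R^o) (GRing.isLinear.Build R 'rV[R]_n R^o *:%R l l_lin).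
have fo := @diff_unique R 'rV[R]_n R^o f df p lc.
have fP := @diff_locallyP R 'rV[R]_n R^o p f.
have fl' : forall e : R, 0 < e -> \forall a \near (0 : 'rV[R]_n),
    `|f (a + p) - (f p + l a)| <= e * `|a|.
  move=> e e0; have [d d0 fd] := fl e e0.
  apply/nbhs_ballP; exists d => //= a.
  rewrite -ball_normE /ball_ /= sub0r normrN => ad.
  by have := fd a ad; rewrite (addrC p a) -addrA -opprD.
have dfE : 'd f p = df :> ('rV[R]_n -> R^o) by apply: fo; apply/eqaddoP.
by split=> //; apply/fP; rewrite dfE; split => //; apply/eqaddoP.
Qed.

Lemma row_mx_norm_le (R : realType) (m n : nat) (a : 'rV[R]_m) (b : 'rV[R]_n) :
  `|row_mx a b| <= Num.max `|a| `|b|.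
Proof.
have coordle k (u : 'rV[R]_k) i j : `|u i j| <= `|u|.
  by rewrite [leRHS]mx_normrE; exact: (le_bigmax _ (fun ij => `|u ij.1 ij.2|) (i, j)).
rewrite [leLHS]mx_normrE; apply: bigmax_le => [|[i j] _ /=].
  by rewrite le_max normr_ge0.
by rewrite mxE; case: fintype.splitP => k _; rewrite le_max coordle ?orbT.
Qed.

(** [K] is read in the product of [chart_at z] with itself, and [feature_map_differentiable] is
    applied with [psi := cinv c]. Since [tspace z] uses the coordinates of that same chart, no
    change of coordinates enters. *)
Lemma rkhs_differentiable (R : realType) (P : atlas R) (hP : manifold P)
    (K : P -> P -> R) (hK : @Ck_fun R (mprod P P) 2 (fun x => K x.1 x.2))
    (HK : set (P -> R)) (ip : (P -> R) -> (P -> R) -> R) (hHK : rkhs K HK ip)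
    (z : P) : exists L : tspace z -> P -> R,
  (forall v, HK (L v)) /\
  (forall f v, HK f -> pairing (dfun f z) v = ip f (L v)).
Proof.
pose c := chart_at z; pose p := cmap c z; pose d := mdim P.
have hc : charts c := chart_at_charts hP z.
have zc : cdom c z := chart_at_dom hP z.
have cz : cinv c p = z := chart_cancel hP hc zc.
pose cc := prod_chart c c : chart (mprod P P) 'rV[R]_(mdim P + mdim P).
pose k := (fun x : P * P => K x.1 x.2) \o cinv cc.
have kC2 : @Ck R _ R^o 2 (cmap cc @` cdom cc) k by apply: hK; exists c, c.
have Uo : open (cmap c @` cdom c) by have := chart_open hP hc hc; rewrite setIid.
have WE : cmap cc @` cdom cc =
    (lsubmx @^-1` (cmap c @` cdom c)) `&` (rsubmx @^-1` (cmap c @` cdom c)).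
  apply/seteqP; split => [_ [[x y] [/= xc yc] <-]|u [[x xc xu] [y yc yu]]] /=.
    by rewrite row_mxKl row_mxKr; split; [exists x | exists y].
  by exists (x, y) => //=; rewrite xu yu hsubmxK.
have Wo : open (cmap cc @` cdom cc).
  rewrite WE; apply: openI; apply: open_comp => // u _;
    apply: differentiable_continuous.
    exact: differentiable_lsubmx.
  exact: differentiable_rsubmx.
have Wx : (cmap cc @` cdom cc) (row_mx p p) by exists (z, z).
pose il (a : 'rV[R]_(mdim P)) : 'rV[R]_(mdim P + mdim P) := row_mx a 0.
pose ir (a : 'rV[R]_(mdim P)) : 'rV[R]_(mdim P + mdim P) := row_mx 0 a.
have il_lin t a b : il (t *: a + b) = t *: il a + il b.
  by rewrite /il scale_row_mx add_row_mx scaler0 addr0.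
have ir_lin t a b : ir (t *: a + b) = t *: ir a + ir b.
  by rewrite /ir scale_row_mx add_row_mx scaler0 addr0.
have il_le a : `|il a| <= `|a|.
  by apply: le_trans (row_mx_norm_le _ _) _; rewrite normr0 ge_max lexx normr_ge0.
have ir_le a : `|ir a| <= `|a|.
  by apply: le_trans (row_mx_norm_le _ _) _; rewrite normr0 ge_max lexx normr_ge0.
(* The second difference of [k] along [il a] and [ir b] moves each argument of the kernel
   separately, so [M] is the mixed Hessian block. *)
pose M a b : R := 'd (fun y => 'd k y (il a) : R^o) (row_mx p p) (ir b).
have Ml b : scalar (M ^~ b).
  move=> t a a'; rewrite /= /M il_lin; exact: (second_derivative_scalar _ kC2 Wx).
have Mr a : scalar (M a).
  by move=> t b b'; rewrite /M ir_lin; exact: linearP.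
have kE u v : k (row_mx u v) = K (cinv c u) (cinv c v).
  by rewrite /k /= row_mxKl row_mxKr.
have [|L [HL L_lin L_diff]] := @feature_map_differentiable R P K HK ip hHK
    'rV[R]_(mdim P) (cinv c) p M Ml Mr.
  move=> e e0; have [r r0 kr] := second_difference_littleo Wo Wx kC2 e0.
  exists r => // a b ar br; rewrite !addr0.
  have := kr (il a) (ir b) (le_lt_trans (il_le a) ar) (le_lt_trans (ir_le b) br).
  rewrite -/(M a b) /il /ir !add_row_mx !addr0 !kE.
  move/le_trans; apply.
  rewrite -!mulrA ler_wpM2l ?(ltW e0)// ler_pM//; (exact: il_le || exact: ir_le).
exists L; split => // f v Hf.
have [df dfE] := @differentiable_littleo R _ (f \o cinv c) p _ (L_lin f Hf)
  (fun e e0 => L_diff f e Hf e0).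
by rewrite /pairing /dfun lfunE /= -/c -/p dfE.
Qed.

(** * Linear algebra for the Gram map and for [Bsharp] *)

(** Families [I -> vT] are transported to the finite-dimensional space [{ffun I -> vT}], where an
    injective endomorphism is invertible. *)
Lemma linear_ker0_bijective (F : fieldType) (vT : vectType F) (I : finType)
    (S : (I -> vT) -> (I -> vT)) :
  (forall (a : F) u v, S (a *: u + v) = a *: S u + S v) ->
  (forall u, S u = 0 -> u = 0) ->
  exists S' : (I -> vT) -> (I -> vT), cancel S S' /\ cancel S' S.
Proof.
move=> S_lin S0.
pose f (u : {ffun I -> vT}) : {ffun I -> vT} := [ffun i => S u i].
have f_lin : linear f.
  move=> a u v; apply/ffunP => i; rewrite !ffunE.
  have -> : (a *: u + v : {ffun I -> vT}) =
      a *: (u : I -> vT) + (v : I -> vT) :> (I -> vT).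
    by apply/funext => j; rewrite !ffunE.
  by rewrite S_lin.
pose fL : {linear {ffun I -> vT} -> {ffun I -> vT}} :=
  HB.pack f (GRing.isLinear.Build _ _ _ _ f f_lin).
have ker0 : lker (linfun fL) == 0%VS.
  apply/lker0P => u v; rewrite !lfunE /= => fuv; apply/subr0_eq.
  have SB : S (u - v : {ffun I -> vT}) = 0.
    apply/funext => i.
    have := congr1 (fun w : {ffun I -> vT} => w i) (linearB fL u v).
    by rewrite /= fuv subrr !ffunE.
  by apply/ffunP => i; rewrite (S0 _ SB) ffunE.
pose toff (u : I -> vT) : {ffun I -> vT} := [ffun i => u i].
have toffK u : toff u = u :> (I -> vT) by apply/funext => i; rewrite ffunE.
exists (fun u => ((linfun fL)^-1%VF (toff u) : {ffun I -> vT}) : I -> vT); split => u.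
  have -> : toff (S u) = linfun fL (toff u).
    by rewrite lfunE; apply/ffunP => i; rewrite !ffunE toffK.
  by rewrite lker0_lfunK// toffK.
have := lker0_lfunVK ker0 (toff u).
rewrite [X in X = _]lfunE => fw; apply/funext => i.
by have := congr1 (fun w : {ffun I -> vT} => w i) fw; rewrite !ffunE.
Qed.

Section Sharp.
Variables (R : realType) (P : atlas R) (B : bivector P) (Bsharp : bundle_map P).
Hypotheses (B_linear_r : forall z (alpha : cotspace z), scalar (B alpha))
  (hBsharp : is_sharp B Bsharp).

Lemma pairing_inj (z : P) (v w : tspace z) :
  (forall alpha : cotspace z, pairing alpha v = pairing alpha w) -> v = w.
Proof.
move=> vw; apply/rowP => j.
have coord_lin : scalar (fun u : 'rV[R]_(mdim P) => u 0 j).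
  by move=> a u u'; rewrite !mxE.
pose l : {linear 'rV[R]_(mdim P) -> R^o} := HB.pack
  ((fun u => u 0 j) : 'rV[R]_(mdim P) -> R^o)
  (GRing.isLinear.Build R 'rV[R]_(mdim P) R^o *:%R _ coord_lin).
by have := vw (linfun l); rewrite /pairing !lfunE.
Qed.

(** [Bsharp] is specified only through [B]; it inherits linearity from the second slot of [B]
    because covectors separate tangent vectors. *)
Lemma sharp_linear (z : P) (a : R) (al be : cotspace z) :
  Bsharp (a *: al + be) = a *: Bsharp al + Bsharp be.
Proof.
apply: pairing_inj => om; rewrite -hBsharp B_linear_r !hBsharp /pairing.
by rewrite linearP.
Qed.

(** A linear form on the cotangent space is evaluation at a tangent vector. With [l] the metric
    product by a fixed vector, this gives the transpose of [Bsharp]. *)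
Lemma sharp_adjoint (z : P) (l : tspace z -> R) : scalar l ->
  exists w : tspace z, forall be, l (Bsharp be) = pairing be w.
Proof.
move=> l_lin.
have sl_lin : scalar (fun be : cotspace z => l (Bsharp be)).
  by move=> a al be; rewrite sharp_linear l_lin.
pose sl : {linear cotspace z -> R^o} := HB.pack
  ((fun be => l (Bsharp be)) : cotspace z -> R^o)
  (GRing.isLinear.Build R (cotspace z) R^o *:%R _ sl_lin).
have coord_lin j : scalar (fun u : 'rV[R]_(mdim P) => u 0 j).
  by move=> a u u'; rewrite !mxE.
pose co j : {linear 'rV[R]_(mdim P) -> R^o} := HB.pack
  ((fun u => u 0 j) : 'rV[R]_(mdim P) -> R^o)
  (GRing.isLinear.Build R 'rV[R]_(mdim P) R^o *:%R _ (coord_lin j)).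
pose al j : cotspace z := linfun (co j).
(* The coordinates of [w] are the values of the form on the dual basis [al]. *)
exists (\row_j sl (al j)) => be.
have beE : be = \sum_j be (delta_mx 0 j) *: al j.
  apply/lfunP => v; rewrite sum_lfunE {1}(row_sum_delta v) linear_sum.
  by apply: eq_bigr => j _; rewrite linearZ scale_lfunE lfunE; exact: mulrC.
rewrite -[LHS]/(sl be) {1}beE linear_sum /pairing.
rewrite [in RHS](row_sum_delta (\row_j _)) linear_sum.
by apply: eq_bigr => j _; rewrite !linearZ mxE; exact: mulrC.
Qed.

End Sharp.

(** * Ridge regression for an operator [A] with adjoint [A'] *)

Section RidgeRegression.
Variables (R : realType) (P : atlas R) (g : metric P) (hg : riemannian g).
Variables (N : nat) (ZN : 'I_N -> P).
Variables (T : Type) (K : T -> T -> R) (HK : set (T -> R)).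
Variables (ip : (T -> R) -> (T -> R) -> R) (hHK : rkhs K HK ip).
Variables (A : (T -> R) -> tspaceN ZN) (A' : tspaceN ZN -> T -> R).

Local Notation gN := (@gN R P g N ZN).

Hypothesis A_linear : forall (a : R) h h', HK h -> HK h' ->
  forall i, A (a *: h + h') i = a *: A h i + A h' i.
Hypothesis A'_rkhs : forall c, HK (A' c).
Hypothesis A_adjoint : forall c h, HK h -> ip h (A' c) = gN c (A h).

Let S (lambda : R) (c : tspaceN ZN) : tspaceN ZN :=
  fun i => A (A' c) i + (lambda * N%:R) *: c i.

Let E (lambda : R) (X : tspaceN ZN) (h : T -> R) : R :=
  N%:R^-1 * (\sum_(i < N) Defs.gnorm g (A h i - X i) ^+ 2) + lambda * ip h h.

Lemma metric_ZDl x (a : R) (u v w : tspace x) :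
  g (a *: u + v) w = a * g u w + g v w.
Proof. by rewrite !(Defs.metric_sym hg _ w) (metric_linear hg). Qed.

Lemma metric_ZDr x (a : R) (u v w : tspace x) :
  g w (a *: u + v) = a * g w u + g w v.
Proof. exact: (metric_linear hg). Qed.

Lemma metric0l x (w : tspace x) : g 0 w = 0.
Proof.
have := metric_ZDl (-1) 0 0 w; rewrite scaler0 addr0 => ->.
by rewrite mulN1r addNr.
Qed.

Lemma metric_ge0 x (v : tspace x) : 0 <= g v v.
Proof.
have [->|v0] := eqVneq v 0; first by rewrite metric0l.
exact/ltW/(metric_pos hg).
Qed.

Lemma gnorm_sqr x (v : tspace x) : Defs.gnorm g v ^+ 2 = g v v.
Proof. by rewrite sqr_sqrtr ?metric_ge0. Qed.

Lemma gN_ge0 c : 0 <= gN c c.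
Proof. by apply: sumr_ge0 => i _; exact: metric_ge0. Qed.

Lemma gN_eq0 c : gN c c = 0 -> forall i, c i = 0.
Proof.
move=> /eqP; rewrite psumr_eq0; last by move=> i _; exact: metric_ge0.
move=> /allP c0 i; have /eqP ci0 := c0 i (mem_index_enum i).
by apply/eqP; apply: contraPT ci0 => /(metric_pos hg) /gt_eqF /eqP.
Qed.

(** Linearity of [A'] follows from the adjoint identity: tested against the linearity defect itself,
    it shows that the defect has norm zero. *)
Lemma adjoint_linear (a : R) (c c' : tspaceN ZN) :
  A' (fun i => a *: c i + c' i) = a *: A' c + A' c'.
Proof.
have Hr := rkhsD hHK (rkhsZ hHK a (A'_rkhs c)) (A'_rkhs c').
set c'' := fun i => a *: c i + c' i; apply: subr0_eq.
have Hd := rkhsB hHK (A'_rkhs c'') Hr; apply: (ip_eq0 hHK Hd).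
set d := (X in HK X) in Hd; change (ip d (A' c'' - (a *: A' c + A' c')) = 0).
rewrite (ipBr hHK)// (ipDr hHK)//; last exact: (rkhsZ hHK).
rewrite (ipZr hHK)// !A_adjoint// mulr_sumr -big_split -sumrB.
by apply: big1 => i _; rewrite /= metric_ZDl subrr.
Qed.

(** If [S lambda u = 0], the squared norm of [A' u] equals [- lambda * N * gN u u]; being
    nonnegative, it forces [u = 0]. *)
Lemma ridge_bijective (lambda : R) : (0 < N)%N -> 0 < lambda ->
  exists S' : tspaceN ZN -> tspaceN ZN,
    cancel (S lambda) S' /\
    cancel S' (S lambda).
Proof.
move=> N0 l0; have lN : 0 < lambda * N%:R by rewrite mulr_gt0// ltr0n.
apply: (@linear_ker0_bijective R 'rV[R]_(mdim P) 'I_N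
  (S lambda)) => [a u v|u Su0].
  apply/funext => i.
  rewrite -[LHS]/(A (A' (fun i => a *: u i + v i)) i +
    (lambda * N%:R) *: (a *: u i + v i)).
  rewrite adjoint_linear A_linear; [|exact: A'_rkhs..].
  rewrite -[RHS]/(a *: (A (A' u) i + (lambda * N%:R) *: u i) +
    (A (A' v) i + (lambda * N%:R) *: v i)).
  move: (A (A' u) i) (A (A' v) i) (u i) (v i) => x y u' v'.
  by rewrite !scalerDr !scalerA (mulrC _ a) addrACA.
apply/funext => i; apply: gN_eq0.
(* The trailing [+ 0] gives the right-hand side the shape that [metric_ZDr] expects. *)
have Su i' : A (A' u) i' = (- (lambda * N%:R)) *: u i' + 0.
  rewrite addr0 scaleNr; apply/eqP; rewrite -addr_eq0; apply/eqP.
  exact: (congr1 (fun c : 'I_N -> 'rV[R]_(mdim P) => c i') Su0).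
have uu : ip (A' u) (A' u) = - (lambda * N%:R) * gN u u.
  rewrite A_adjoint// mulr_sumr; apply: eq_bigr => i' _.
  by rewrite Su metric_ZDr [X in _ + X](Defs.metric_sym hg) metric0l addr0.
have := rkhs_ip_ge0 hHK (A'_rkhs u).
rewrite uu mulNr oppr_ge0 pmulr_rle0// => gu.
by apply/eqP; rewrite eq_le gu gN_ge0.
Qed.

(* As [X = A (A' c) + lambda N c], the first-order terms of the objective at
   [A' c] cancel. *)
Lemma ridge_expansion (lambda : R) (XN c : tspaceN ZN) (h : T -> R) :
  (0 < N)%N -> S lambda c = XN -> HK h ->
  E lambda XN h =
  E lambda XN (A' c) +
  N%:R^-1 * gN (A (h - A' c)) (A (h - A' c)) +
  lambda * ip (h - A' c) (h - A' c).
Proof.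
move=> N0 cX Hh; have He := A'_rkhs c; set e := A' c in He *.
have Nn0 : N%:R != 0 :> R by rewrite pnatr_eq0 -lt0n.
set d := h - e; have Hd : HK d := rkhsB hHK Hh He.
have hE : h = d + e by rewrite subrK.
have Ae i : A e i - XN i = - (lambda * N%:R) *: c i + 0.
  by rewrite -cX /S opprD addrA subrr add0r addr0 scaleNr.
have Ah i : A h i - XN i = 1 *: A d i + (- (lambda * N%:R) *: c i + 0).
  have := A_linear 1 Hd He i; rewrite scale1r -hE -Ae => ->.
  by move: (A d i) (A e i) (XN i) => x y t; rewrite addrA.
clearbody d.
have sumE : \sum_(i < N) Defs.gnorm g (A h i - XN i) ^+ 2 =
    \sum_(i < N) Defs.gnorm g (A e i - XN i) ^+ 2 - 2 * (lambda * N%:R) * gN c (A d)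
    + gN (A d) (A d).
  rewrite mulr_sumr -sumrB -big_split; apply: eq_bigr => i _ /=.
  rewrite !gnorm_sqr Ae Ah !(metric_ZDl, metric_ZDr) !metric0l.
  rewrite !(Defs.metric_sym hg _ 0) !metric0l (Defs.metric_sym hg (A d i) (c i)).
  by ring.
rewrite /E sumE hE (ipDl hHK Hd He (rkhsD hHK Hd He)) !(ipDr hHK)//.
by rewrite (ip_sym hHK He Hd) -(A_adjoint _ Hd); field.
Qed.

(** In [ridge_expansion] both added terms are nonnegative, which gives minimality; the one weighted
    by [lambda] vanishes only at [h = A' c], which gives uniqueness. *)
Lemma ridge_argmin (lambda : R) (XN c : tspaceN ZN) :
  (0 < N)%N -> 0 < lambda -> S lambda c = XN ->
  unique_argmin HK (E lambda XN) (A' c).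
Proof.
move=> N0 l0 cX; have He := A'_rkhs c.
have NV : 0 <= N%:R^-1 :> R by rewrite invr_ge0.
split=> // h Hh; have Hd := rkhsB hHK Hh He.
  rewrite (ridge_expansion N0 cX Hh) -addrA lerDl.
  by rewrite addr_ge0// mulr_ge0 ?gN_ge0 ?(ltW l0) ?(rkhs_ip_ge0 hHK Hd).
move=> /(_ _ He); rewrite (ridge_expansion N0 cX Hh) -addrA gerDl => le0.
have d0 : ip (h - A' c) (h - A' c) = 0.
  apply/eqP; rewrite eq_le (rkhs_ip_ge0 hHK Hd) andbT -(pmulr_rle0 _ l0).
  by apply: le_trans le0; rewrite lerDr mulr_ge0 ?gN_ge0.
exact/subr0_eq/(ip_eq0 hHK).
Qed.

End RidgeRegression.

Theorem theorem3p13 (R : realType)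
  (P : atlas R) (hP : manifold P)
  (br : (P -> R) -> (P -> R) -> P -> R) (hbr : poisson_bracket br)
  (B : bivector P) (hB : poisson_tensor br B)
  (Bsharp : bundle_map P) (hBsharp : is_sharp B Bsharp)
  (g : metric P) (hg : riemannian g)
  (gk : forall k, metric (itangent k (mprod P P)))
  (hgk : forall k, riemannian (gk k) /\ complete_metric (gk k))
  (K : P -> P -> R) (hKm : mercer K)
  (hK : @Cb R (mprod P P) gk 3 (fun p => K p.1 p.2))
  (HK : set (P -> R)) (ip : (P -> R) -> (P -> R) -> R) (hHK : rkhs K HK ip)
  (gamma : P -> R) (C : R) (hC : 0 < C)
  (hgamma : forall z, 0 < gamma z <= C ^+ 2)
  (hJ : forall z (v : tspace z),
     g z (compatible_structure g Bsharp v) (compatible_structure g Bsharp v)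
     <= gamma z * g z v v)
  (dO : measure_display) (Omega : measurableType dO) (Pr : probability Omega R)
  (H : P -> R) (hH : Coo_fun H)
  (N : nat) (hN : (0 < N)%N)
  (Z : 'I_N -> Omega -> P) (hZ : iid Pr Z)
  (sigma : R) (hsigma : 0 <= sigma)
  (eps : forall n w, tspace (Z n w))
  (heps_rv : forall n,
     @random_element _ Omega (tangent P) (fun w => tpoint (eps n w)))
  (heps_indep :
     @independent _ _ Omega Pr (tangent P) N (fun n w => tpoint (eps n w)))
  (heps : forall n, centered_noise Pr g sigma (eps n))
  (lambda : R) (hlambda : 0 < lambda) (w : Omega) :
  let ZN := fun n => Z n w in
  let XN : tspaceN ZN := fun n => hamiltonian Bsharp H (Z n w) + eps n w in
  exists inv_gram : tspaceN ZN -> tspaceN ZN,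
    [/\ cancel (regularized_gram g Bsharp K lambda) inv_gram,
        cancel inv_gram (regularized_gram g Bsharp K lambda) &
        unique_argmin HK (objective g Bsharp ip lambda XN)
          (kernel_expansion g Bsharp K (inv_gram XN))].
Proof.
move=> ZN XN.
have hK2 : @Ck_fun R (mprod P P) 2 (fun x => K x.1 x.2).
  by move=> c hc; apply: CkS; have [hK3 _] := hK; exact: hK3.
have [L HL] : exists L : forall i : 'I_N, tspace (ZN i) -> P -> R, forall i,
    (forall v, HK (L i v)) /\
    (forall f v, HK f -> pairing (dfun f (ZN i)) v = ip f (L i v)).
  have LE i := cid (rkhs_differentiable hP hK2 hHK (ZN i)).
  by exists (fun i => projT1 (LE i)) => i; exact: projT2 (LE i).
have B_lin (z : P) (al : cotspace z) : scalar (B z al) := tensor_linear_r hB al.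
(* The representers [L i v] reduce linearity of the differential on [HK] to linearity of [ip]. *)
have dfun_lin (a : R) h h' i : HK h -> HK h' ->
    dfun (a *: h + h') (ZN i) = a *: dfun h (ZN i) + dfun h' (ZN i).
  move=> Hh Hh'; apply/lfunP => v; have [Lv LE] := HL i.
  rewrite add_lfunE scale_lfunE.
  have := LE (a *: h + h') v (rkhsD hHK (rkhsZ hHK a Hh) Hh').
  by rewrite (ipZDl hHK)// -!LE.
have A_lin (a : R) h h' : HK h -> HK h' -> forall i,
    hamiltonianN Bsharp ZN (a *: h + h') i =
    a *: hamiltonianN Bsharp ZN h i + hamiltonianN Bsharp ZN h' i.
  move=> Hh Hh' i; rewrite /hamiltonianN.
  by rewrite /hamiltonian dfun_lin// (sharp_linear B_lin).
(* [W i c] is the transpose of [Bsharp] applied to the covector [g c]. *)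
have [W HW] : exists W : forall i : 'I_N, tspace (ZN i) -> tspace (ZN i),
    forall i c be, g (ZN i) c (Bsharp (ZN i) be) = pairing be (W i c).
  have WE i (c : tspace (ZN i)) :=
    cid (sharp_adjoint B_lin hBsharp (metric_linear hg c)).
  by exists (fun i c => projT1 (WE i c)) => i c; exact: projT2 (WE i c).
(* At [y], each summand is [d K_y] applied to [W i (c i)], hence the product of [K y] with
   [L i (W i (c i))]; the reproducing property evaluates that representer at [y]. *)
have expansionE (c : tspaceN ZN) :
    kernel_expansion g Bsharp K c = \sum_(i < N) L i (W i (c i)).
  apply/funext => y; rewrite fct_sumE; apply: eq_bigr => i _.
  have [Lv LE] := HL i; have HKy := rkhs_kernel hHK y.
  rewrite /hamiltonianN /hamiltonian HW LE// (ip_sym hHK)//.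
  exact: (rkhs_reproducing hHK).
have HLW (c : tspaceN ZN) i : HK (L i (W i (c i))) by have [] := HL i.
have HE (c : tspaceN ZN) : HK (kernel_expansion g Bsharp K c).
  rewrite expansionE.
  (* As [N] is positive, the kernel at the first sample point supplies the element of [HK] from
     which zero is built. *)
  exact: (rkhs_sum hHK (rkhs_kernel hHK (ZN (Ordinal hN))) (HLW c)).
have adjoint (c : tspaceN ZN) h : HK h ->
    ip h (kernel_expansion g Bsharp K c) = gN g c (hamiltonianN Bsharp ZN h).
  move=> Hh; rewrite expansionE (ip_sumr hHK)//; apply: eq_bigr => i _.
  by have [_ LE] := HL i; rewrite /hamiltonianN /hamiltonian HW LE.
(* With [A] the map [hamiltonianN] and [A'] the map [kernel_expansion], the abstract [S] and [E]
   unfold to [regularized_gram] and [objective]. *)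
have [S' [SK S'K]] := ridge_bijective hg hHK A_lin HE adjoint hN hlambda.
exists S'; split => //.
exact: (ridge_argmin hg hHK A_lin HE adjoint hN hlambda (S'K XN)).
Qed.
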